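(* Let $G$ be a walk-regular graph on $n$ vertices with Laplacian matrix $L$, and let $k$ be an integer with $2\le k\le n$. Then $$\frac{n(k-1)}{2k}\,\lambda_{\max}(L)\;=\;\min_{d\in\mathbb{R}^n,\ d^{\mathrm T}u_n=0}\ \frac{n(k-1)}{2k}\,\lambda_{\max}\bigl(L+\operatorname{Diag}(d)\bigr).$$ Moreover, for $k=2$, the number $\frac{n(k-1)}{2k}\lambda_{\max}(L)=\frac n4\lambda_{\max}(L)$ equals the optimal value of the semidefinite program $$\max\ \tfrac12\operatorname{tr}(LY)\quad\text{subject to}\quad \operatorname{diag}(Y)=u_n,\quad kY-J_n\succeq 0,\quad Y\ge 0$$ with $k=2$, where $Y$ ranges over real symmetric $n\times n$ matrices.
   Context: Graphs are finite, simple and undirected. A graph with adjacency matrix $A$ is walk-regular if $A^{\ell}$ has constant diagonal for every nonnegative integer $\ell$. The Laplacian matrix is $L=\operatorname{Diag}(Au_n)-A$, where $u_n$ is the all-ones vector of length $n$ and $\operatorname{Diag}(v)$ is the diagonal matrix with diagonal $v$; $\operatorname{diag}(Y)$ is the vector of diagonal entries of $Y$. $\lambda_{\max}(M)$ is the largest eigenvalue of the real symmetric matrix $M$. $J_n$ is the $n\times n$ all-ones matrix, $M\succeq 0$ means $M$ is positive semidefinite, and $Y\ge 0$ means $Y$ is entrywise nonnegative. *)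

(* Defs.v *)
From mathcomp Require Import all_boot all_order all_algebra.
From mathcomp Require Import classical_sets reals.

Set Implicit Arguments.
Unset Strict Implicit.
Unset Printing Implicit Defensive.

Import Order.TTheory GRing.Theory Num.Theory.

Local Open Scope classical_set_scope.
Local Open Scope ring_scope.

Definition is_minimum (R : realType) (S : set R) (m : R) : Prop :=
  S m /\ lbound S m.

Definition is_maximum (R : realType) (S : set R) (m : R) : Prop :=
  S m /\ ubound S m.

(* The largest real eigenvalue of M. It exists for every real symmetric matrix
   of positive order; the default 0 is returned when there is none. *)
Definition lambda_max (R : realType) (n : nat) (M : 'M[R]_n) : R :=
  xget 0 (is_maximum [set a : R | eigenvalue M a]).

Definition psdmx (R : realType) (n : nat) (M : 'M[R]_n) : Prop :=
  M \is symmetricmx /\ forall x : 'cV[R]_n, 0 <= (x^T *m M *m x) 0 0.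

Definition ones (R : realType) (n : nat) : 'cV[R]_n := const_mx 1.

Definition all_ones_mx (R : realType) (n : nat) : 'M[R]_n := const_mx 1.

(* diag_mx takes a row vector. *)
Definition Diag (R : realType) (n : nat) (v : 'cV[R]_n) : 'M[R]_n :=
  diag_mx v^T.

Definition diag (R : realType) (n : nat) (Y : 'M[R]_n) : 'cV[R]_n :=
  \col_i Y i i.

(* A finite simple graph on n vertices is a symmetric irreflexive relation e
   on 'I_n; both properties are hypotheses wherever a graph is meant. *)
Definition adjacency (R : realType) (n : nat) (e : rel 'I_n) : 'M[R]_n :=
  \matrix_(i, j) (e i j)%:R.

Definition laplacian (R : realType) (n : nat) (e : rel 'I_n) : 'M[R]_n :=
  Diag (adjacency R e *m ones R n) - adjacency R e.

Definition walk_regular (R : realType) (n : nat) (e : rel 'I_n) : Prop :=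
  forall (l : nat) (i j : 'I_n),
    (adjacency R e ^+ l) i i = (adjacency R e ^+ l) j j.

Definition sdp_feasible (R : realType) (n k : nat) (Y : 'M[R]_n) : Prop :=
  [/\ Y \is symmetricmx,
      diag Y = ones R n,
      psdmx (k%:R *: Y - all_ones_mx R n)
    & forall i j, 0 <= Y i j].

(* Main.v *)
(* Let [E] be the projector on the eigenspace of the largest eigenvalue [l] of
   [L]. A walk-regular graph is regular, so [E] is a polynomial in the adjacency
   matrix and has constant diagonal; rescale it to [W] with unit diagonal. If [d]
   sums to 0 then [tr (Diag d W) = 0], hence
   [n l = tr ((L + Diag d) W) <= n lambda_max (L + Diag d)].
   For [k = 2], [Y = (J + W) / 2] is feasible with value [n l / 4], and this is
   optimal because [tr (L (2 Y - J)) <= l tr (2 Y - J) = n l] and [L J = 0]. *)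

Require Import Defs.
From mathcomp Require Import all_boot all_order all_algebra.
From mathcomp Require Import classical_sets reals.
From mathcomp Require Import spectral sesquilinear.
From mathcomp Require complex.
From mathcomp Require Import ring lra.

Import Order.TTheory GRing.Theory Num.Theory.

Local Open Scope classical_set_scope.
Local Open Scope ring_scope.

(** * Traces, rank-one matrices and matrix polynomials *)

Lemma symmetricmxE (R : fieldType) (n : nat) (M : 'M[R]_n) :
  (M \is symmetricmx) = (M^T == M).
Proof. by rewrite qualifE /= expr0 scale1r map_mx_id // eq_sym. Qed.

Lemma mxtrace_rank1 (R : comNzRingType) (n : nat) (u : 'rV[R]_n) (Z : 'M[R]_n) :
  \tr (u^T *m u *m Z) = (u *m Z *m u^T) 0 0.
Proof. by rewrite -mulmxA mxtrace_mulC trace_mx11. Qed.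

Lemma mxtrace_unit_diag (R : nzRingType) (n : nat) (W : 'M[R]_n) :
  (forall i, W i i = 1) -> \tr W = n%:R.
Proof.
by move=> W1; rewrite /mxtrace (eq_bigr _ (fun i _ => W1 i)) sumr_const card_ord.
Qed.

Lemma psdmx_mxtrace_ge0 (R : realType) (n : nat) (Z : 'M[R]_n) (u : 'rV[R]_n) :
  psdmx Z -> 0 <= \tr (u^T *m u *m Z).
Proof. by case=> _ /(_ u^T); rewrite trmxK mxtrace_rank1. Qed.

Lemma mul_horner_mx_eigenvector (R : comNzRingType) (n : nat) (M : 'M[R]_n.+1)
    (x : 'rV[R]_n.+1) (a : R) (q : {poly R}) :
  x *m M = a *: x -> x *m horner_mx M q = q.[a] *: x.
Proof.
move=> xM; elim/poly_ind: q => [|q c IHq].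
  by rewrite rmorph0 mulmx0 horner0 scale0r.
rewrite rmorphD rmorphM /= horner_mx_X horner_mx_C mulmxDr mulmxA IHq.
by rewrite -scalemxAl xM mul_mx_scalar !hornerE scalerDl scalerA.
Qed.

(** * Real eigenvectors of a symmetric matrix from its complex diagonalisation *)

Section EigenFrame.

Import complex.

Lemma Re_mul_real (R : rcfType) (z : R[i]) (x : R) :
  Re (z * real_complex R x) = Re z * x.
Proof. by case: z => a b /=; rewrite mulr0 subr0. Qed.

Lemma Im_mul_real (R : rcfType) (z : R[i]) (x : R) :
  Im (z * real_complex R x) = Im z * x.
Proof. by case: z => a b /=; rewrite mulr0 add0r. Qed.

Lemma Re_sum (R : rcfType) (I : finType) (F : I -> R[i]) :
  Re (\sum_i F i) = \sum_i Re (F i).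
Proof. by apply: (big_morph (@Re R)) => // -[a b] [c d]. Qed.

Lemma Im_sum (R : rcfType) (I : finType) (F : I -> R[i]) :
  Im (\sum_i F i) = \sum_i Im (F i).
Proof. by apply: (big_morph (@Im R)) => // -[a b] [c d]. Qed.

Lemma Re_conj_mul (R : rcfType) (z w : R[i]) :
  Re (Num.conj z * w) = Re z * Re w + Im z * Im w.
Proof. by case: z w => a b [c d]; rewrite /= mulNr opprK. Qed.

(* The rows of a unitary matrix diagonalising [M] over [R[i]], split into their
   real and imaginary parts: these span but need not be independent over [R]. *)
Lemma symmetric_eigen_frame (R : rcfType) (n : nat) (M : 'M[R]_n) :
  M^T = M ->
  exists (I : finType) (d : I -> R) (v : I -> 'rV[R]_n),
    (forall j, v j *m M = d j *: v j) /\ \sum_j (v j)^T *m v j = 1%:M.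
Proof.
move=> Msym; pose MC := map_mx (real_complex R) M.
have MCsym : MC \is symmetricmx by rewrite symmetricmxE map_trmx Msym.
have MCreal : MC \is a mxOver Num.real.
  by apply/mxOverP => i j; rewrite mxE complex_real.
have /realsym_hermsym/(_ MCreal) MCherm := MCsym.
have /hermitian_spectral_diag_real/mxOverP sp_real := MCherm.
have /hermitian_normalmx/orthomx_spectralP := MCherm.
have := spectral_unitarymx MC; have := spectral_unit MC.
set U := spectralmx MC in sp_real *; set sp := spectral_diag MC in sp_real *.
move=> Uunit Uunitary MCE.
have UM : U *m MC = diag_mx sp *m U by rewrite {1}MCE !mulmxA mulmxV // mul1mx.
have UU : (map_mx Num.conj U^T) *m U = 1%:M.
  by rewrite -invmx_unitary // mulVmx.
pose d i := Re (sp 0 i).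
have spE i : sp 0 i = real_complex R (d i) by rewrite /d RRe_real.
(* [M] and its eigenvalues are real, so this equation passes to the real and the imaginary part of
   row [i] of [U], each satisfying the eigenvector equation for [d i]. *)
have UMi i j : \sum_k U i k * real_complex R (M k j) = U i j * real_complex R (d i).
  have /matrixP/(_ i j) := UM; rewrite mul_diag_mx !mxE spE mulrC => <-.
  by apply: eq_bigr => k _; rewrite !mxE.
exists ('I_n + 'I_n)%type.
exists (fun s => match s with inl i => d i | inr i => d i end).
exists (fun s => match s with
  | inl i => \row_j Re (U i j) | inr i => \row_j Im (U i j) end).
split.
  case=> i; apply/rowP => j; rewrite !mxE.
    rewrite mulrC -Re_mul_real -UMi Re_sum; apply: eq_bigr => k _.
    by rewrite Re_mul_real !mxE.
  rewrite mulrC -Im_mul_real -UMi Im_sum; apply: eq_bigr => k _.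
  by rewrite Im_mul_real !mxE.
(* The real part of [conj(U)^T U = 1] is the sum of the rank-one matrices of both families, by
   [Re_conj_mul]. *)
rewrite big_sumType /= -big_split /=; apply/matrixP => a b.
have /matrixP/(_ a b) := UU; rewrite !mxE => /(congr1 (@Re R)).
rewrite Re_sum summxE => UUab.
transitivity (Re ((a == b)%:R : R[i])); last by case: (a == b).
rewrite -UUab; apply: eq_bigr => k _.
by rewrite !mxE Re_conj_mul !big_ord1 !mxE.
Qed.

End EigenFrame.

(** * The largest eigenvalue and its eigenprojector *)

Section LambdaMax.

Variables (R : realType) (n : nat) (M : 'M[R]_n.+1).
Hypothesis Msym : M^T = M.

(** The frame spans, so every eigenvalue is some [d j] with [v j] nonzero, and finitely many values
    have a maximum; the default 0 of [lambda_max] is never the reason for its value. *)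
Lemma is_maximum_lambda_max :
  is_maximum [set a : R | eigenvalue M a] (lambda_max M).
Proof.
have [I [d [v [vM v1]]]] := symmetric_eigen_frame _ _ _ Msym.
have [j0 vj0] : exists j, v j != 0.
  apply/existsP; apply/contraT; rewrite negb_exists => /forallP v0.
  have /matrixP/(_ 0 0)/eqP := v1.
  rewrite big1 => [|j _]; last by move/negPn/eqP: (v0 j) => ->; rewrite mulmx0.
  by rewrite !mxE eq_sym oner_eq0.
(* Zero vectors are left out: a zero [v j] does not certify [d j] as an eigenvalue. *)
case: (@arg_maxP _ _ _ j0 (fun j => v j != 0) d vj0) => j vj dmax.
have ex : is_maximum [set a : R | eigenvalue M a] (d j).
  split=> [|a]; first by apply/eigenvalueP; exists (v j).
  move=> /eigenvalueP[x xM x0].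
  have [k xvk] : exists k, x *m (v k)^T != 0.
    apply/existsP; apply/contraT; rewrite negb_exists => /forallP xv0.
    case/eqP: x0; rewrite -[x]mulmx1 -v1 mulmx_sumr big1 // => k _.
    by move/negPn/eqP: (xv0 k) => xvk; rewrite mulmxA xvk mul0mx.
  (* By symmetry [x M (v k)^T] can be evaluated from either side; [x] and [v k] are not orthogonal,
     so their eigenvalues agree. *)
  have dk : a *: (x *m (v k)^T) = d k *: (x *m (v k)^T).
    rewrite scalemxAl -xM -mulmxA -{1}Msym -trmx_mul vM.
    by rewrite linearZ /= -scalemxAr.
  have -> : a = d k.
    by apply/eqP; move/eqP: dk; rewrite -subr_eq0 -scalerBl scaler_eq0
      (negPf xvk) orbF subr_eq0.
  by apply: dmax; apply: contraNneq xvk => ->; rewrite trmx0 mulmx0.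
by rewrite /lambda_max; apply: (@xgetPex _ 0 (is_maximum _)); exists (d j).
Qed.

(** Over the frame, the trace of [M Z] is a sum of the [d j] with the nonnegative weights
    [v j Z (v j)^T], and these weights add up to the trace of [Z]. *)
Lemma mxtrace_mul_psd_le (Z : 'M[R]_n.+1) :
  psdmx Z -> \tr (M *m Z) <= lambda_max M * \tr Z.
Proof.
move=> Zpsd; have [I [d [v [vM v1]]]] := symmetric_eigen_frame _ _ _ Msym.
have trE (X : 'M[R]_n.+1) : \tr X = \sum_j \tr ((v j)^T *m v j *m X).
  by rewrite -raddf_sum /= -mulmx_suml v1 mul1mx.
rewrite (trE (M *m Z)) (trE Z) mulr_sumr; apply: ler_sum => j _.
have -> : \tr ((v j)^T *m v j *m (M *m Z)) = d j * \tr ((v j)^T *m v j *m Z).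
  by rewrite !mulmxA -(mulmxA _ (v j)) vM -scalemxAr -scalemxAl linearZ.
have [v0|v0] := eqVneq (v j) 0.
  by rewrite v0 mulmx0 mul0mx mxtrace0 !mulr0.
rewrite ler_wpM2r ?psdmx_mxtrace_ge0 //.
by apply: is_maximum_lambda_max.2; apply/eigenvalueP; exists (v j).
Qed.

(* Lagrange interpolation on the spectrum of [M] makes the projector on the top
   eigenspace a polynomial in [M]. *)
Lemma top_eigenprojector : exists p : {poly R},
  let E := horner_mx M p in
  [/\ psdmx E, 0 < \tr E & M *m E = lambda_max M *: E].
Proof.
have [I [d [v [vM v1]]]] := symmetric_eigen_frame _ _ _ Msym.
set l := lambda_max M.
(* Repeated values of [d] only repeat factors: [p] is still 1 at [l] and 0 at every other [d j]. *)
pose p := \prod_(j | d j != l) ((l - d j)^-1 *: ('X - (d j)%:P)).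
have pl : p.[l] = 1.
  rewrite horner_prod big1 // => j dj.
  by rewrite hornerZ hornerXsubC mulVf // subr_eq0 eq_sym.
have pd j : p.[d j] = (d j == l)%:R.
  have [->//|dj] := eqVneq (d j) l.
  by rewrite horner_prod (bigD1 j) //= hornerZ hornerXsubC subrr mulr0 mul0r.
have qE q : horner_mx M q = \sum_j q.[d j] *: ((v j)^T *m v j).
  rewrite -[LHS]mul1mx -v1 mulmx_suml; apply: eq_bigr => j _.
  by rewrite -mulmxA (mul_horner_mx_eigenvector _ _ _ _ _ _ (vM j)) -scalemxAr.
have pE := qE p.
exists p; split.
- split.
    rewrite symmetricmxE pE linear_sum; apply/eqP/eq_bigr => j _.
    by rewrite linearZ /= trmx_mul trmxK.
  move=> x; rewrite pE mulmx_sumr mulmx_suml summxE; apply: sumr_ge0 => j _.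
  rewrite -scalemxAr -scalemxAl mxE pd mulr_ge0 ?ler0n //.
  rewrite !mulmxA -[x^T *m _]trmxK trmx_mul !trmxK -mulmxA mxE big_ord1 mxE.
  by rewrite -expr2 sqr_ge0.
- have trE (u : 'rV[R]_n.+1) : \tr (u^T *m u) = \sum_i u 0 i ^+ 2.
    rewrite mxtrace_mulC trace_mx11 mxE; apply: eq_bigr => i _.
    by rewrite mxE -expr2.
  have [/eigenvalueP[x xM x0] _] := is_maximum_lambda_max.
  have tr_ge0 j : 0 <= \tr (p.[d j] *: ((v j)^T *m v j)).
    rewrite linearZ /= trE pd mulr_ge0 ?ler0n // sumr_ge0 // => i _.
    exact: sqr_ge0.
  rewrite pE raddf_sum /= lt0r sumr_ge0 ?andbT //.
  (* If the trace were 0, each nonnegative summand would vanish and the projector would be 0, yet it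
     maps the top eigenvector [x] to [p.[l] *: x = x]. *)
  apply: contraNneq x0 => tr0.
  have {}tr0 j : p.[d j] *: v j = 0.
    move/eqP: tr0; rewrite psumr_eq0 // => /allP/(_ j).
    rewrite mem_index_enum linearZ /= mulf_eq0 trE psumr_eq0; last first.
      by move=> i _; exact: sqr_ge0.
    move=> /(_ isT)/orP[/eqP->|/allP v0]; first by rewrite scale0r.
    apply/rowP => i; rewrite !mxE.
    by have /implyP/(_ isT) := v0 i (mem_index_enum i);
      rewrite sqrf_eq0 => /eqP->; rewrite mulr0.
  rewrite -[x]scale1r -pl -(mul_horner_mx_eigenvector _ _ _ _ _ _ xM) pE big1 ?mulmx0 // => j _.
  by rewrite scalemxAr tr0 mulmx0.
- rewrite pE mulmx_sumr scaler_sumr; apply: eq_bigr => j _.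
  rewrite -scalemxAr mulmxA -{1}Msym -trmx_mul vM linearZ /= -scalemxAl !scalerA.
  by rewrite pd; have [->|_] := eqVneq (d j) l; rewrite ?mulr1 ?mul1r ?mulr0 ?mul0r.
Qed.

End LambdaMax.

(** Evaluate the quadratic form at the sum of two basis vectors. For a unit diagonal this bounds the
    entries below by -1, which makes [(J + W) / 2] entrywise nonnegative. *)
Lemma psdmx_lower_bound (R : realType) (n : nat) (Z : 'M[R]_n) (i j : 'I_n) :
  psdmx Z -> - (Z i i + Z j j) <= 2 * Z i j.
Proof.
case=> Zsym Zpos; have Zt : Z j i = Z i j.
  by move: Zsym; rewrite symmetricmxE => /eqP/matrixP/(_ i j); rewrite mxE.
have := Zpos (delta_mx i 0 + delta_mx j 0).
rewrite [(_ + _)^T]raddfD /= !trmx_delta !mulmxDl !mulmxDr -!rowE -!colE !mxE Zt; lra.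
Qed.

Lemma eq_diag_horner_mx (R : comNzRingType) (n : nat) (A : 'M[R]_n.+1)
    (q : {poly R}) (i j : 'I_n.+1) :
  (forall l, (A ^+ l) i i = (A ^+ l) j j) ->
  horner_mx A q i i = horner_mx A q j j.
Proof.
move=> wr; rewrite -[q]coefK poly_def linear_sum !summxE; apply: eq_bigr => k _.
by rewrite linearZ /= rmorphXn /= horner_mx_X !mxE wr.
Qed.

(** * Laplacians of walk-regular graphs *)

Section WalkRegular.

Variables (R : realType) (n : nat) (e : rel 'I_n.+1).
Hypotheses (e_sym : symmetric e) (e_wr : walk_regular R e).

Let A : 'M[R]_n.+1 := adjacency R e.
Let L : 'M[R]_n.+1 := laplacian R e.

(** Closed walks of length 2 at a vertex go along an edge and back, so their number is the
    degree. *)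
Lemma walk_regular_degree (i : 'I_n.+1) : (A *m ones R n.+1) i 0 = (A ^+ 2) 0 0.
Proof.
rewrite [RHS](e_wr 2 0 i) expr2 !mxE; apply: eq_bigr => j _.
by rewrite !mxE (e_sym j i) mulr1; case: (e i j); rewrite ?mulr1 ?mulr0.
Qed.

Lemma laplacian_horner_mx : L = horner_mx A (((A ^+ 2) 0 0)%:P - 'X).
Proof.
rewrite rmorphB /= horner_mx_C horner_mx_X; congr (_ - _).
by apply/matrixP => i j; rewrite -(walk_regular_degree i) !mxE.
Qed.

Lemma laplacian_trmx : L^T = L.
Proof.
rewrite /L /laplacian linearB /= tr_diag_mx; congr (_ - _).
by apply/matrixP => i j; rewrite !mxE e_sym.
Qed.

Lemma laplacian_mul_all_ones : L *m all_ones_mx R n.+1 = 0.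
Proof.
apply/matrixP => i j; rewrite mulmxBl mul_diag_mx !mxE mulr1.
by apply/eqP; rewrite subr_eq0; apply/eqP/eq_bigr => k _; rewrite !mxE.
Qed.

Lemma eq_diag_horner_mx_laplacian (q : {poly R}) (i j : 'I_n.+1) :
  horner_mx L q i i = horner_mx L q j j.
Proof.
(* By regularity [L = r I - A] with [r] the degree, so substituting [r - X] into [q] gives a
   polynomial in [A]. *)
have -> : horner_mx L q = horner_mx A (q \Po (((A ^+ 2) 0 0)%:P - 'X)).
  elim/poly_ind: q => [|q c IHq]; first by rewrite comp_poly0 !rmorph0.
  rewrite comp_poly_MXaddC !rmorphD !rmorphM /= IHq !horner_mx_C horner_mx_X.
  by rewrite laplacian_horner_mx.
by apply: eq_diag_horner_mx => l; exact: e_wr.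
Qed.

(* The projector on the top eigenspace of [L], rescaled to have unit diagonal. *)
Lemma top_eigenspace_correlation : exists W : 'M[R]_n.+1,
  [/\ psdmx W, forall i, W i i = 1 & L *m W = lambda_max L *: W].
Proof.
have [p [Epsd trE0 LE]] := top_eigenprojector _ _ _ laplacian_trmx.
set E := horner_mx L p in Epsd trE0 LE.
have Ei i : E i i = E 0 0 by exact: eq_diag_horner_mx_laplacian.
have E00 : 0 < E 0 0.
  move: trE0; rewrite /mxtrace (eq_bigr _ (fun i _ => Ei i)) sumr_const card_ord.
  by rewrite pmulrn_lgt0.
exists ((E 0 0)^-1 *: E); split.
- case: Epsd => Esym Epos; split.
    by move: Esym; rewrite !symmetricmxE linearZ /= => /eqP->.
  by move=> x; rewrite -scalemxAr -scalemxAl mxE mulr_ge0 // invr_ge0 ltW.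
- by move=> i; rewrite mxE Ei mulVf // gt_eqF.
- by rewrite -scalemxAr LE !scalerA mulrC.
Qed.

Lemma mxtrace_Diag_mul (d : 'cV[R]_n.+1) (W : 'M[R]_n.+1) :
  (forall i, W i i = 1) -> \tr (Diag d *m W) = (d^T *m ones R n.+1) 0 0.
Proof.
move=> W1; rewrite /mxtrace mxE; apply: eq_bigr => i _.
by rewrite mul_diag_mx !mxE W1.
Qed.

Lemma lambda_max_laplacian_le (d : 'cV[R]_n.+1) :
  d^T *m ones R n.+1 = 0 -> lambda_max L <= lambda_max (L + Diag d).
Proof.
move=> d0; have [W [Wpsd W1 LW]] := top_eigenspace_correlation.
have trW := mxtrace_unit_diag _ _ _ W1.
have /mxtrace_mul_psd_le/(_ W Wpsd) : (L + Diag d)^T = L + Diag d.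
  by rewrite [(_ + _)^T]raddfD /= laplacian_trmx tr_diag_mx.
rewrite mulmxDl raddfD /= LW linearZ /= mxtrace_Diag_mul // d0 mxE addr0 trW.
by rewrite ler_pM2r ?ltr0Sn.
Qed.

Lemma sdp_optimum_laplacian :
  is_maximum [set 1 / 2 * \tr (L *m Y) | Y in
               [set Y : 'M[R]_n.+1 | sdp_feasible 2 Y]]
             (n.+1%:R / 4 * lambda_max L).
Proof.
pose J := all_ones_mx R n.+1.
split.
  have [W [Wpsd W1 LW]] := top_eigenspace_correlation.
  have trW := mxtrace_unit_diag _ _ _ W1.
  have WE : 2%:R *: (2^-1 *: (J + W)) - J = W.
    by rewrite scalerA mulfV ?pnatr_eq0 // scale1r addrC addKr.
  exists (2^-1 *: (J + W)); last first.
    rewrite -scalemxAr linearZ /= mulmxDr laplacian_mul_all_ones add0r LW.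
    by rewrite linearZ /= trW; field.
  split; last 1 first.
  - move=> i j; have := psdmx_lower_bound _ _ _ i j Wpsd.
    by rewrite !mxE !W1; lra.
  - case: Wpsd; rewrite !symmetricmxE => /eqP Wt _.
    by rewrite linearZ /= raddfD /= Wt trmx_const.
  - by apply/colP => i; rewrite !mxE W1; field.
  - by rewrite WE.
move=> _ [Y [_ Yd Ypsd _] <-].
have := mxtrace_mul_psd_le _ _ _ laplacian_trmx _ Ypsd.
rewrite mulmxBr laplacian_mul_all_ones subr0 -scalemxAr linearZ /=.
have -> : \tr (2%:R *: Y - J) = n.+1%:R.
  apply: mxtrace_unit_diag => i.
  have /colP/(_ i) := Yd; rewrite !mxE => ->; ring.
rewrite /L; lra.
Qed.

End WalkRegular.

Theorem theorem6 (R : realType) (n : nat) (e : rel 'I_n)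
    (e_sym : symmetric e) (e_irr : irreflexive e)
    (e_wr : walk_regular R e)
    (k : nat) (k_ge2 : (2 <= k)%N) (k_le_n : (k <= n)%N) :
  let L := laplacian R e in
  let c := n%:R * (k%:R - 1) / (2 * k%:R) : R in
  is_minimum
    [set c * lambda_max (L + Diag d) | d in
      [set d : 'cV[R]_n | d^T *m ones R n = 0]]
    (c * lambda_max L)
  /\ (k = 2%N ->
      c * lambda_max L = n%:R / 4 * lambda_max L
      /\ is_maximum
           [set 1 / 2 * \tr (L *m Y) | Y in
             [set Y : 'M[R]_n | sdp_feasible k Y]]
           (c * lambda_max L)).
Proof.
(* The bounds on [k] exclude order 0, where there is no largest eigenvalue. *)
case: n e e_sym e_irr e_wr k_le_n => [|n] e e_sym e_irr e_wr k_le_n L c.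
  by move: k_le_n; rewrite leqn0 => /eqP k0; rewrite k0 in k_ge2.
have c_ge0 : 0 <= c.
  rewrite mulr_ge0 ?invr_ge0 ?mulr_ge0 ?ler0n // subr_ge0 ler1n.
  exact: ltnW.
split.
  split.
    (* The minimum is attained at [d = 0]. *)
    exists 0 => /=; first by rewrite trmx0 mul0mx.
    by rewrite /Diag trmx0 raddf0 addr0.
  move=> _ [d d0 <-]; rewrite ler_wpM2l //.
  exact: (lambda_max_laplacian_le _ _ _ e_sym e_wr).
move=> k2; have cE : c = n.+1%:R / 4 by rewrite /c k2; field.
rewrite cE; split=> //; rewrite k2.
exact: (sdp_optimum_laplacian _ _ _ e_sym e_wr).
Qed.
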